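(* If $G$ is a connected $2K_2$-free graph, then $c(G)\leq 2$.
   Context: All graphs are finite, simple, undirected and non-empty. $2K_2$ is the disjoint union of two copies of the complete graph on two vertices. A graph $G$ is $H$-free if no induced subgraph of $G$ is isomorphic to $H$. Cops and robbers is a turn-based, perfect-information game played on a connected graph $G$ by a group of $k$ cops against one robber. On the first turn, the cops first each choose a starting vertex (several cops may share a vertex), then the robber chooses a starting vertex. Afterwards the cops and the robber alternate turns, starting with the cops; on the cops' turn each cop either stays on its current vertex or moves to an adjacent vertex, and on the robber's turn the robber does the same. The cops win if at some point a cop occupies the same vertex as the robber (the robber is captured); the robber wins if it escapes indefinitely. The cop number $c(G)$ is the smallest number $k$ of cops for which the cops have a winning strategy on $G$. *)

(* Defs.v *)
From mathcomp Require Import all_boot.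
From mathcomp Require Import boolp.

Set Implicit Arguments.
Unset Strict Implicit.
Unset Printing Implicit Defensive.

(* A graph is given by its adjacency relation on a finite type of vertices. *)

Definition simple_graph (T : finType) (e : rel T) : Prop :=
  symmetric e /\ irreflexive e.

Definition connected_graph (T : finType) (e : rel T) : Prop :=
  forall x y : T, connect e x y.

Definition graph_iso (S T : Type) (f : rel S) (e : rel T) : Prop :=
  exists2 phi : S -> T, bijective phi & forall x y, e (phi x) (phi y) = f x y.

Definition induced (T : finType) (e : rel T) (A : {set T}) :
  rel {x : T | x \in A} := fun x y => e (val x) (val y).

Definition free_of (S T : finType) (f : rel S) (e : rel T) : Prop :=
  forall A : {set T}, ~ graph_iso (induced e (A := A)) f.

Definition complete (T : finType) : rel T := fun x y => x != y.

Definition disjoint_union (S T : finType) (f : rel S) (e : rel T) :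
  rel (S + T)%type := fun u v =>
  match u, v with
  | inl x, inl y => f x y
  | inr x, inr y => e x y
  | _, _ => false
  end.

Definition two_K2 : rel ('I_2 + 'I_2)%type :=
  disjoint_union (@complete 'I_2) (@complete 'I_2).

Section CopsAndRobbers.
Variables (T : finType) (e : rel T).

Definition move : rel T := fun x y => (x == y) || e x y.

(* A strategy maps the sequence of vertices occupied so far by the robber
   (oldest first) to the positions of the k cops after their next turn: its
   value at [::] is the initial placement.  The cops' own past positions are
   determined by the strategy and this sequence. *)
Definition cop_strategy (k : nat) : Type := seq T -> {ffun 'I_k -> T}.

Definition legal_strategy k (s : cop_strategy k) : Prop :=
  forall (h : seq T) (x : T) (i : 'I_k), move (s h i) (s (rcons h x) i).

Definition robber_play (r : nat -> T) : Prop := forall n, move (r n) (r n.+1).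

(* s (mkseq r n) is the cops' position when the robber takes its turn to r n;
   the cops then move to s (mkseq r n.+1). *)
Definition captures k (s : cop_strategy k) (r : nat -> T) : Prop :=
  exists n (i : 'I_k), s (mkseq r n) i = r n \/ s (mkseq r n.+1) i = r n.

Definition cops_win (k : nat) : Prop :=
  exists2 s : cop_strategy k, legal_strategy s &
    forall r, robber_play r -> captures s r.

Lemma cops_win_card : cops_win #|T|.
Proof.
exists (fun _ => [ffun i => enum_val i]).
  by move=> h x i; rewrite /move !ffunE eqxx.
move=> r _; exists 0, (enum_rank (r 0)); left.
by rewrite ffunE enum_rankK.
Qed.

Lemma ex_cops_win : exists k, `[< cops_win k >].
Proof. by exists #|T|; apply/asboolP/cops_win_card. Qed.

Definition cop_number : nat := ex_minn ex_cops_win.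

End CopsAndRobbers.

(* Main.v *)
Require Import Defs.
From mathcomp Require Import all_boot.
From mathcomp Require Import boolp.

(** Work in the complement H of G: it has no induced 4-cycle, a cop or robber may
    move exactly between non-H-adjacent vertices, and a robber evading two cops is
    H-adjacent to both after each of his moves.  A dominated vertex can be removed by
    a retraction.  Otherwise, a robber at t cannot move while the cops stand on two
    G-adjacent H-neighbours of t, and the cops can walk at will among such pairs;
    so whenever u is an H-neighbour of t and w is H-adjacent to neither, the cops
    can force him to a common H-neighbour of u and w that is not one of t.  Take a
    largest H-clique Q whose common neighbourhood N(Q) contains a possible robber
    position t and two non-H-adjacent neighbours of t.  By maximality N(Q) is a
    5-cycle c1 ... c5.  Moving from c1, c3 to c4, c5 against a robber at c2 and then
    back towards c4, c1 drives the robber to some f in Q.  Exchanging f with c1 and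
    with c4 in Q gives two more 5-cycles around f, and the induced 4-cycle that they
    create with the first one is a contradiction. *)

Set Implicit Arguments.
Unset Strict Implicit.
Unset Printing Implicit Defensive.

(** * Winning in boundedly many rounds *)

Section Game.
Variables (T : finType) (e : rel T) (k : nat).
Implicit Types p q : {ffun 'I_k -> T}.

Fixpoint win (n : nat) p (r : T) : bool :=
  if n is m.+1 then
    [exists q : {ffun 'I_k -> T}, [forall i, move e (p i) (q i)] &&
      ([exists i, q i == r] || [forall r', move e r r' ==> win m q r'])]
  else false.

Lemma winS n p r : win n p r -> win n.+1 p r.
Proof.
elim: n p r => [//|n IHn] p r /existsP[q /andP[pq /orP[qr|qwin]]].
  by apply/existsP; exists q; rewrite pq qr.
apply/existsP; exists q; rewrite pq /=; apply/orP; right.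
by apply/forallP => r'; apply/implyP => rr'; apply/IHn/(implyP (forallP qwin r')).
Qed.

Lemma win_leq m n p r : m <= n -> win m p r -> win n p r.
Proof.
by move=> /subnK <-; elim: (n - m) => [//|d IHd] /IHd; rewrite addSn; apply: winS.
Qed.


(** The reply belongs to the least winning bound at the position, so one [q] lowers every bound at
    once and the resulting strategy needs no count of rounds. *)
Lemma win_response r p :
  exists q, (forall i, move e (p i) (q i)) /\
    forall n, win n p r -> (exists i, q i = r) \/
      forall r', move e r r' -> exists2 m, m < n & win m q r'.
Proof.
have [ex_n|no_n] := pselect (exists n, win n p r); last first.
  exists p; split=> [i|n pn]; first by rewrite /move eqxx.
  by case: no_n; exists n.
case: (ex_minnP ex_n) => [[//|m] /existsP[q /andP[/forallP pq qwin]] m_min].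
exists q; split=> // n /m_min m_lt_n.
case/orP: qwin => [/existsP[i /eqP]|/forallP qwin]; first by left; exists i.
by right=> r' rr'; exists m => //; apply: implyP rr'.
Qed.

Lemma win_cops_win p : (forall r, exists n, win n p r) -> cops_win e k.
Proof.
move=> pwin.
have [next nextP] := choice (fun pr : {ffun 'I_k -> T} * T =>
  win_response pr.2 pr.1).
pose s h := foldl (fun p r => next (p, r)) p h.
exists s => [h x i|r r_play].
  by rewrite /s -cats1 foldl_cat /=; have [+ _] := nextP (s h, x); apply.
suff capt n : forall j, win n (s (mkseq r j)) (r j) -> captures s r.
  by have [n /(capt n 0)] := pwin (r 0).
elim/ltn_ind: n => n IHn j.
have sS : s (mkseq r j.+1) = next (s (mkseq r j), r j).
  by rewrite /s mkseqS -cats1 foldl_cat.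
move=> /(proj2 (nextP (_, _))) /= [[i ir]|].
  by exists j, i; right; rewrite sS.
by case/(_ _ (r_play j)) => m m_lt_n; rewrite -sS; apply: (IHn m m_lt_n j.+1).
Qed.

End Game.

(** * The complement graph and evasion *)

(* Adjacency in the complement graph; [~~ far e] is [move e]. *)
Definition far (T : finType) (e : rel T) : rel T := fun x y => ~~ move e x y.

Lemma farC (T : finType) (e : rel T) : symmetric e -> symmetric (far e).
Proof. by move=> eC x y; rewrite /far /move eq_sym eC. Qed.

Lemma farP (T : finType) (e : rel T) (x y : T) :
  [\/ x = y, e x y | far e x y].
Proof.
rewrite /far /move; have [|_] := eqVneq x y; first by constructor 1.
by case: (boolP (e x y)) => _ /=; [constructor 2 | constructor 3].
Qed.

Lemma e_far (T : finType) (e : rel T) (x y : T) : e x y -> far e x y -> False.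
Proof. by rewrite /far /move orbC => ->. Qed.

Lemma farxx (T : finType) (e : rel T) (x : T) : far e x x -> False.
Proof. by rewrite /far /move eqxx. Qed.

Lemma e_move (T : finType) (e : rel T) (x y : T) : e x y -> move e x y.
Proof. by rewrite /move orbC => ->. Qed.

Definition no_2K2 (T : finType) (e : rel T) : Prop :=
  forall a b c d, e a b -> e c d ->
    far e a c -> far e a d -> far e b c -> far e b d -> False.

(* [S c d r]: the cops on [c] and [d] are to move and the robber on [r] can escape
   forever. *)
Definition evasion (T : finType) (e : rel T) (S : T -> T -> T -> Prop) : Prop :=
  [/\ forall c d, exists r, S c d r,
      forall c d r, S c d r -> far e c r /\ far e d r &
      forall c d r c' d', S c d r -> move e c c' -> move e d d' ->
        exists2 r', move e r r' & S c' d' r'].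

(** Connectedness as an induction principle, a form that passes easily through the retraction
    [shadow]. *)
Definition closed_sets_trivial (T : finType) (e : rel T) : Prop :=
  forall B : T -> Prop, (forall x y, B x -> e x y -> B y) ->
    forall x y, B x -> B y.

(* In the complement, no open neighbourhood lies in the closed neighbourhood of
   another vertex. *)
Definition undominated (T : finType) (e : rel T) : Prop :=
  forall x y, x != y -> exists2 z, far e x z & e y z.

(** * Forced robber moves without dominated vertices *)

Section Undominated.
Variables (T : finType) (e : rel T) (S : T -> T -> T -> Prop).
Hypotheses (eC : symmetric e) (eI : irreflexive e) (free : no_2K2 e).
Hypotheses (conn : closed_sets_trivial e) (undom : undominated e).
Hypothesis evS : evasion e S.

Local Notation h := (far e).
Let hC : symmetric h := farC eC.

Let start c d : exists r, S c d r. Proof. by case: evS. Qed.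
Let safe c d r : S c d r -> h c r /\ h d r. Proof. by case: evS => _ + _; apply. Qed.
Let next c d r c' d' : S c d r -> move e c c' -> move e d d' ->
  exists2 r', move e r r' & S c' d' r'.
Proof. by case: evS => _ _; apply. Qed.

Let exx x : e x x -> False. Proof. by rewrite eI. Qed.

Definition reached (t : T) : Prop := exists c d, S c d t.
Local Notation W := reached.

(** A move of the robber from [t] to a safe [r] would form an induced $2K_2$ with the edge [c' d'],
    so he stays. *)
Lemma stuck c d t c' d' : S c d t -> move e c c' -> move e d d' ->
  h c' t -> h d' t -> e c' d' -> S c' d' t.
Proof.
move=> Scdt cc' dd' c't d't c'd'; have [r tr Sr] := next Scdt cc' dd'.
have [c'r d'r] := safe Sr.
case/orP: tr => [/eqP-> //|tr].
by case: (free c'd' tr c't c'r d't d'r).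
Qed.

(** Each cop has a neighbour H-adjacent to [t], as [t] does not dominate it. If no combination of
    old and new positions were an edge, the two moves would form an induced $2K_2$. If the cops
    coincide, moving one of them suffices. *)
Lemma reached_edge t : W t -> exists u v, e u v /\ S u v t.
Proof.
move=> [c [d Scdt]]; have [ct dt] := safe Scdt.
have neq_t x : h x t -> t != x.
  by move=> xt; apply/eqP => tx; rewrite tx in xt; apply: farxx xt.
case: (farP e c d) => [cd|cd|cd]; last 2 first.
- by exists c, d.
- have [a ta ca] := undom (neq_t _ ct); have [b tb db] := undom (neq_t _ dt).
  rewrite hC in ta; rewrite hC in tb.
  case: (farP e a d) => [ad|ad|ad].
  + by rewrite ad in ca; case: (e_far ca cd).
  + by exists a, d; split=> //; apply: stuck Scdt _ _ _ _ _ => //;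
      rewrite /move ?eqxx ?ca ?orbT.
  case: (farP e c b) => [cb|cb|cb].
  + by rewrite -cb eC in db; case: (e_far db cd).
  + by exists c, b; split=> //; apply: stuck Scdt _ _ _ _ _ => //;
      rewrite /move ?eqxx ?db ?orbT.
  case: (farP e a b) => [ab|ab|ab].
  + by rewrite ab in ca; case: (e_far ca cb).
  + by exists a, b; split=> //; apply: stuck Scdt _ _ _ _ _ => //; apply: e_move.
  + by case: (free ca db cd cb ad ab).
- rewrite -cd in Scdt dt; have [a ta ca] := undom (neq_t _ ct).
  rewrite hC in ta; exists c, a; split=> //.
  by apply: stuck Scdt _ _ _ _ _ => //; rewrite /move ?eqxx ?ca ?orbT.
Qed.

(** By $2K_2$-freeness some end of the starting edge equals or is adjacent to an end of [u v]; the
    cops slide along the connecting edges while [stuck] holds the robber on [t]. *)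
Lemma free_cops t u v : W t -> h u t -> h v t -> e u v -> S u v t.
Proof.
move=> /reached_edge[a [b [ab Sab]]] ut vt uv.
have swap x y : e x y -> S x y t -> S y x t.
  move=> xy Sxy; have [xt yt] := safe Sxy.
  by apply: stuck Sxy _ _ _ _ _ => //; rewrite ?e_move // eC.
(* The cop on [x] goes to [z] and the cop on [y] follows to [x]. *)
have shift x y z : h z t -> e x y -> S x y t -> e x z -> S x z t.
  move=> zt xy Sxy xz; have [xt yt] := safe Sxy.
  apply: swap; first by rewrite eC.
  by apply: stuck Sxy _ _ _ _ _ => //; rewrite ?e_move // eC.
have ba : e b a by rewrite eC.
have vu : e v u by rewrite eC.
have main a' b' u' v' : h u' t -> h v' t -> e u' v' -> e a' b' -> S a' b' t ->
    ~~ h a' u' -> S u' v' t.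
  move=> u't v't u'v' a'b' Sa'b'; rewrite negbK => /orP[/eqP a'u'|a'u'].
    by rewrite -a'u' in u'v' *; apply: shift Sa'b' _.
  have u'a' : e u' a' by rewrite eC.
  by apply: (shift _ a') => //; apply: swap => //; apply: shift Sa'b' _.
have Sba := swap _ _ ab Sab.
have [au|au] := boolP (h a u); last exact: (main a b u v).
have [av|av] := boolP (h a v); last by apply: (swap v u) => //; apply: (main a b).
have [bu|bu] := boolP (h b u); last exact: (main b a u v).
have [bv|bv] := boolP (h b v); last by apply: (swap v u) => //; apply: (main b a).
by case: (free ab uv au av bu bv).
Qed.

Lemma response t a b c d : W t -> h a t -> h b t -> e a b ->
  move e a c -> move e b d -> ~~ (h c t && h d t) ->
  exists z, [/\ W z, h z c, h z d & e t z].
Proof.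
move=> Wt at_ bt ab ac bd ncd.
have [z tz Sz] := next (free_cops Wt at_ bt ab) ac bd.
have [cz dz] := safe Sz; exists z; split; try by rewrite hC.
  by exists c, d.
by case/orP: tz => // /eqP tz; rewrite tz cz dz in ncd.
Qed.

(** The cops wait on [u] and a neighbour [v] of [u] that is H-adjacent to [t], then advance to [w]
    and [u]. *)
Lemma response1 t u w : W t -> h u t -> e u w -> e t w ->
  exists z, [/\ W z, h z u, h z w & e t z].
Proof.
move=> Wt ut uw tw.
have [v tv uv] : exists2 v, h t v & e u v.
  by apply: undom; apply/eqP => tu; rewrite tu in ut; apply: farxx ut.
rewrite hC in tv; rewrite eC in uv.
apply: (@response t v u) => //; rewrite ?e_move // /move ?eqxx //.
by apply/negP => /andP[] _ wt; apply: e_far wt; rewrite eC.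
Qed.

(** * Cliques [Q] of H and their common neighbourhoods N(Q), given by [joined Q] *)

Definition clique (Q : {set T}) : Prop := {in Q &, forall f g, f = g \/ h f g}.
Definition joined (Q : {set T}) (x : T) : Prop := {in Q, forall f, h f x}.

Lemma joined_common Q u w z t : e u w -> joined Q u -> joined Q w ->
  h z u -> h z w -> e t z -> joined Q t -> joined Q z.
Proof.
move=> uw Qu Qw zu zw tz Qt f fQ; case: (farP e f z) => // fz.
  by have := Qt f fQ; rewrite fz hC => /(e_far tz).
by case: (free uw fz); rewrite hC // ?Qu ?Qw.
Qed.

(** Induction along [Q]: if the current [w] misses the next element [x], the robber is forced to a
    common H-neighbour of [x] and [w], which $2K_2$-freeness keeps joined to the earlier
    elements. *)
Lemma joined_escape Q t : clique Q -> joined Q t -> W t ->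
  exists2 w, joined Q w & e t w.
Proof.
move=> clQ Qt Wt.
suff [w wQ tw] : exists2 w, {in enum Q, forall f, h f w} & e t w.
  by exists w => // f fQ; apply: wQ; rewrite mem_enum.
have : {subset enum Q <= Q} by move=> f; rewrite mem_enum.
elim: (enum Q) => [_|x s IHs sQ].
  have [c [d /safe[ct _]]] := Wt.
  have [[w tw]|no_w] := pselect (exists w, e t w); first by exists w.
  have ct_eq : c = t.
    by apply: (conn (B := fun x => x = t)) (erefl t) => x y -> ty; case: no_w; exists y.
  by rewrite ct_eq in ct; case: (farxx ct).
have [f fs|w sw tw] := IHs; first by apply: sQ; rewrite inE fs orbT.
have xQ : x \in Q by apply: sQ; rewrite mem_head.
case: (farP e x w) => [xw|xw|xw].
- by rewrite -xw eC in tw; case: (e_far tw); apply: Qt.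
- have [z [_ zx zw tz]] := response1 Wt (Qt _ xQ) xw tw.
  exists z => // f; rewrite inE => /predU1P[-> | fs]; first by rewrite hC.
  have fQ : f \in Q by apply: sQ; rewrite inE fs orbT.
  case: (clQ f x fQ xQ) => [->|fx]; first by rewrite hC.
  case: (farP e f z) => // fz.
    by have := Qt f fQ; rewrite fz hC => /(e_far tz).
  by case: (free xw fz); rewrite hC // sw.
- by exists w => // f; rewrite inE => /predU1P[-> | /sw].
Qed.


Ltac known := solve [assumption | rewrite hC; assumption | rewrite eC; assumption].
Ltac absurd_eq E := exfalso; subst;
  match goal with
  | _ : is_true (far e ?x ?x) |- _ => by apply: (@farxx _ e x)
  | _ : is_true (e ?x ?x) |- _ => by apply: (@exx x)
  | _ : is_true (e ?x ?y), _ : is_true (far e ?x ?y) |- _ => by apply: (@e_far _ e x y)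
  | _ : is_true (e ?x ?y), _ : is_true (far e ?y ?x) |- _ =>
      by apply: (@e_far _ e x y); known
  end.

(** The excluded configuration is the induced 4-cycle [x y w r] of H. *)
Lemma no_square x w y r : e x w -> h y x -> h y w -> h r x -> h r w -> e y r -> False.
Proof. by move=> xw yx yw rx rw yr; apply: (free xw yr); known. Qed.

(** The form in which maximality of [Q] is used: two H-paths of length two in N(Q) with the same
    non-H-adjacent ends coincide once one midpoint is a robber position. *)
Definition rigid (Q : {set T}) : Prop := forall y r x w,
  W y -> joined Q y -> joined Q r -> joined Q x -> joined Q w -> e x w ->
  h y x -> h y w -> h r x -> h r w -> r = y.

(** An induced 5-cycle of H inside N(Q); its non-edges are the edges of G in the last row. *)
Definition pentagon (Q : {set T}) (a b c d f : T) : Prop :=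
  [/\ [/\ W a, W b, W c, W d & W f],
      [/\ joined Q a, joined Q b, joined Q c, joined Q d & joined Q f],
      [/\ h a b, h b c, h c d, h d f & h f a] &
      [/\ e a c, e b d, e c f, e d a & e f b]].

Lemma pentagon_rot Q a b c d f : pentagon Q a b c d f -> pentagon Q b c d f a.
Proof. by case=> -[? ? ? ? ?] [? ? ? ? ?] [? ? ? ? ?] [? ? ? ? ?]; split; split. Qed.

(** * N(Q) is a 5-cycle for rigid [Q] *)

Section Rigid.
Variable Q : {set T}.
Hypothesis Qrigid : rigid Q.

Lemma response_joined t u w : W t -> joined Q t -> joined Q u -> joined Q w ->
  h u t -> e u w -> e t w ->
  exists z, [/\ W z, joined Q z, h z u, h z w & e t z].
Proof.
move=> Wt Qt Qu Qw ut uw tw; have [z [Wz zu zw tz]] := response1 Wt ut uw tw.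
by exists z; split=> //; exact: (joined_common uw Qu Qw zu zw tz Qt).
Qed.

(** The robber can be forced from [t] to a common H-neighbour of [a] and [c]; rigidity makes it [b],
    which he cannot reach from [t]. *)
Lemma no_triangle t a b c :
  W t -> joined Q t -> joined Q a -> joined Q b -> joined Q c ->
  h a t -> h b t -> h a b -> h b c -> e a c -> e t c -> False.
Proof.
move=> Wt Qt Qa Qb Qc at_ bt ab bc ac tc.
have [y [Wy Qy ya yc ty]] := response_joined Wt Qt Qa Qc at_ ac tc.
have E : b = y by apply: (Qrigid (x := a) (w := c)) => //; known.
absurd_eq E.
Qed.

(* A third neighbour [p] of [c2] would give, besides [c1, c5] and [c3, c4], a
   further path [p, p4] to [c4] and [p, q2] to [c5]; a robber in [c4] then has no
   answer to the cops moving from [c3, p4] to [c1, q2], since [c5] is the only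
   common neighbour of the latter. *)
Lemma pentagon_nbr c1 c2 c3 c4 c5 p : pentagon Q c1 c2 c3 c4 c5 ->
  joined Q p -> h p c2 -> p = c1 \/ p = c3.
Proof.
case=> -[W1 W2 W3 W4 W5] [Q1 Q2 Q3 Q4 Q5] [h12 h23 h34 h45 h51].
move=> [e13 e24 e35 e41 e52] Qp p2.
case: (farP e p c3) => [|p3|p3]; [by right| |]; last first.
  case: (farP e p c4) => [E|p4|p4]; first by absurd_eq E.
    by exfalso; apply: (no_triangle (t := c2) (a := p) (b := c3) (c := c4)) => //; known.
  right; apply: (Qrigid (x := c2) (w := c4)) => //; known.
case: (farP e p c1) => [|p1|p1]; [by left| |]; last first.
  case: (farP e p c5) => [E|p5|p5]; first by absurd_eq E.
    by exfalso; apply: (no_triangle (t := c2) (a := p) (b := c1) (c := c5)) => //; known.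
  left; apply: (Qrigid (x := c2) (w := c5)) => //; known.
exfalso.
case: (farP e p c4) => [E|p4|p4]; first by absurd_eq E.
  2: by have E : p = c3 by [apply: (Qrigid (x := c2) (w := c4)) => //; known]; absurd_eq E.
case: (farP e p c5) => [E|p5|p5]; first by absurd_eq E.
  2: by have E : p = c1 by [apply: (Qrigid (x := c2) (w := c5)) => //; known]; absurd_eq E.
have e25 : e c2 c5 by known.
(* [q] and [s] are the vertices called [q2] and [p4] above. *)
have [q [Wq Qq qp q5 e2q]] := response_joined W2 Q2 Qp Q5 p2 p5 e25.
have [s [Ws Qs sp s4 e2s]] := response_joined W2 Q2 Qp Q4 p2 p4 e24.
have q1 : e q c1.
  case: (farP e q c1) => [E|//|q1]; first by absurd_eq E.
  have E : q = c2 by apply: (Qrigid (x := p) (w := c1)) => //; known.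
  absurd_eq E.
have s1 : e s c1.
  case: (farP e s c1) => [E|//|s1]; first by absurd_eq E.
  have E : s = c2 by apply: (Qrigid (x := p) (w := c1)) => //; known.
  absurd_eq E.
have s3 : e s c3.
  case: (farP e s c3) => [E|//|s3]; first by absurd_eq E.
  have E : s = c2 by apply: (Qrigid (x := p) (w := c3)) => //; known.
  absurd_eq E.
have q4 : e q c4.
  case: (farP e q c4) => [E|//|q4]; first by absurd_eq E.
  by exfalso; apply: (no_triangle (t := c4) (a := q) (b := c5) (c := c1)) => //; known.
have s5 : e s c5.
  case: (farP e s c5) => [E|//|s5]; first by absurd_eq E.
  by exfalso; apply: (no_triangle (t := c4) (a := s) (b := c5) (c := c1)) => //; known.
have sq : e s q.
  case: (farP e s q) => [E|//|sq]; first by absurd_eq E.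
  by exfalso; apply: (no_square (x := c4) (w := q) (y := s) (r := c5)) => //; known.
have [y [Wy y1 yq e4y]] : exists y, [/\ W y, h y c1, h y q & e c4 y].
  apply: (@response c4 c3 s c1 q) => //; try first [known | by apply: e_move; known].
  by apply/negP => /andP[] c14 _; apply: e_far c14; known.
have Qy : joined Q y by apply: (joined_common (u := c1) (w := q) (t := c4)) => //; known.
have E : c5 = y by apply: (Qrigid (x := c1) (w := q)) => //; known.
absurd_eq E.
Qed.

(** If [p] is H-adjacent to neither [c1] nor [c2], a robber on [c2] is forced to a common
    H-neighbour of [c1] and [p]. This can only be [c5], so [p] is an H-neighbour of [c5]. *)
Lemma pentagon_full c1 c2 c3 c4 c5 p : pentagon Q c1 c2 c3 c4 c5 ->
  joined Q p -> [\/ p = c1, p = c2 | p = c3] \/ p = c4 \/ p = c5.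
Proof.
move=> C Qp; have C' := pentagon_rot (pentagon_rot (pentagon_rot (pentagon_rot C))).
have [p2|np2] := boolP (h p c2).
  by case: (pentagon_nbr C Qp p2) => ->; left; [constructor 1 | constructor 3].
have [p1|np1] := boolP (h p c1).
  by case: (pentagon_nbr C' Qp p1) => ->; [right; right | left; constructor 2].
case: (farP e p c1) np1 => [-> _|p1 _|->//]; first by left; constructor 1.
case: (farP e p c2) np2 => [-> _|p2 _|->//]; first by left; constructor 2.
have [[W1 W2 W3 W4 W5] [Q1 Q2 Q3 Q4 Q5] [h12 h23 h34 h45 h51] [e13 e24 e35 e41 e52]] := C.
have [||y [Wy Qy y1 yp e2y]] := response_joined W2 Q2 Q1 Qp h12; [known..|].
case: (pentagon_nbr C' Qy y1) => E; last by absurd_eq E.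
rewrite E hC in yp.
have C5 := pentagon_rot (pentagon_rot (pentagon_rot C)).
by case: (pentagon_nbr C5 Qp yp) => ->; [right; left | left; constructor 1].
Qed.

(** [joined_escape] and forced moves extend the H-path [u t v] by [r] and [q]. Further forced moves
    end at robber positions that rigidity identifies with [r], [u] and [v]. *)
Lemma pentagon_exists t u v : clique Q -> W t -> joined Q t ->
  joined Q u -> joined Q v -> h u t -> h v t -> e u v ->
  exists r q, pentagon Q t u r q v.
Proof.
move=> clQ Wt Qt Qu Qv ut vt uv.
have [r [Qr ur tr]] : exists r, [/\ joined Q r, h u r & e t r].
  have [w Qw tw] := joined_escape clQ Qt Wt.
  case: (farP e u w) => [E|uw|uw]; first by absurd_eq E.
    have [z [_ Qz zu _ tz]] := response_joined Wt Qt Qu Qw ut uw tw.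
    by exists z; split=> //; known.
  by exists w.
have vr : e v r.
  case: (farP e v r) => [E|//|vr]; first by absurd_eq E.
  by exfalso; apply: (no_square (x := u) (w := v) (y := t) (r := r)) => //; known.
have [q [Wq Qq qv qr tq]] := response_joined Wt Qt Qv Qr vt vr tr.
have uq : e u q.
  case: (farP e u q) => [E|//|uq]; first by absurd_eq E.
  by exfalso; apply: (no_square (x := u) (w := v) (y := t) (r := q)) => //; known.
have [r' [Wr Qr' r'u r'q tr']] := response_joined Wt Qt Qu Qq ut uq tq.
have E : r = r' by apply: (Qrigid (x := u) (w := q)) => //; known.
rewrite -{}E {r' Qr' r'u r'q tr'} in Wr.
have Wu : W u.
  have [|||y [Wy Qy yr yt qy]] := response_joined (u := r) (w := t) Wq Qq Qr Qt; [known..|].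
  have -> // : u = y by apply: (Qrigid (x := r) (w := t)) => //; known.
have Wv : W v.
  have [|||y [Wy Qy yq yt ry]] := response_joined (u := q) (w := t) Wr Qr Qq Qt; [known..|].
  have -> // : v = y by apply: (Qrigid (x := q) (w := t)) => //; known.
exists r, q; split; split=> //; known.
Qed.

End Rigid.

(** * A largest splitting clique and the contradiction *)

Definition splits (Q : {set T}) : Prop := clique Q /\ exists t u v,
  [/\ W t, h u t, h v t & e u v] /\ [/\ joined Q t, joined Q u & joined Q v].

Lemma clique_setU1 (Q : {set T}) x : clique Q -> joined Q x -> clique (x |: Q).
Proof.
move=> clQ Qx f g /setU1P[->|fQ] /setU1P[->|gQ]; [by left| | |exact: clQ].
  by right; rewrite hC; apply: Qx.
by right; apply: Qx.
Qed.

Lemma joined_setU1 (Q : {set T}) x y : h x y -> joined Q y -> joined (x |: Q) y.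
Proof. by move=> xy Qy f /setU1P[->//|/Qy]. Qed.

Lemma joined_notin (Q : {set T}) x : joined Q x -> x \notin Q.
Proof. by move=> Qx; apply/negP => /Qx /farxx. Qed.

(** If [r] were H-adjacent to [y], it could be added to [Q], with [y], [x], [w] still splitting; if
    G-adjacent, it would close an induced 4-cycle of H. *)
Lemma max_splits_rigid (Q : {set T}) : clique Q ->
  (forall Q', splits Q' -> #|Q'| <= #|Q|) -> rigid Q.
Proof.
move=> clQ maxQ y r x w Wy Qy Qr Qx Qw xw yx yw rx rw.
case: (farP e r y) => [//|ry|ry].
  by case: (no_square xw rx rw yx yw ry).
have: splits (r |: Q).
  split; first exact: clique_setU1.
  exists y, x, w; split; split=> //; try known; apply: joined_setU1 => //.
by move/maxQ; rewrite cardsU1 (joined_notin Qr) add1n ltnn.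
Qed.

Lemma undominated_no_evasion (x0 : T) : False.
Proof.
have ex0 : exists n, `[< exists2 Q, splits Q & #|Q| = n >].
  exists #|@set0 T|; apply/asboolP; exists set0 => //.
  split; first by move=> f g; rewrite inE.
  have [t St] := start x0 x0.
  have Wt : W t by exists x0, x0.
  have [u [v [uv /safe[ut vt]]]] := reached_edge Wt.
  by exists t, u, v; split; split=> // f; rewrite inE.
have bounded n : `[< exists2 Q, splits Q & #|Q| = n >] -> n <= #|T|.
  by move/asboolP => [Q _ <-]; apply: max_card.
case: (ex_maxnP ex0 bounded) => m /asboolP[
  Q [clQ [t [u [v [[Wt ut vt uv] [Qt Qu Qv]]]]]] cardQ] maxm.
have rig Q' : clique Q' -> #|Q'| = m -> rigid Q'.
  move=> clQ' cardQ'; apply: max_splits_rigid => // Q'' spl.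
  by rewrite cardQ'; apply/maxm/asboolP; exists Q''.
have Qrig := rig Q clQ cardQ.
have [r [q C]] := pentagon_exists Qrig clQ Wt Qt Qu Qv ut vt uv.
have {u v r q t uv Wt ut vt Qt Qu Qv C} [c1 [c2 [c3 [c4 [c5 C]]]]] :
    exists c1 c2 c3 c4 c5, pentagon Q c1 c2 c3 c4 c5 by exists t, u, r, q, v.
have [[W1 W2 W3 W4 W5] [Q1 Q2 Q3 Q4 Q5]] := C.
move=> [h12 h23 h34 h45 h51] [e13 e24 e35 e41 e52].
have [y [Wy y4 y5 e2y]] : exists y, [/\ W y, h y c4, h y c5 & e c2 y].
  apply: (@response c2 c1 c3 c4 c5) => //; try first [known | by apply: e_move; known].
  by apply/negP => /andP[] c42 _; apply: e_far c42; known.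
(* Were [y] H-adjacent to [c1], it would lie in N(Q) and hence on the 5-cycle, where no vertex
   fits. *)
have ey1 : e y c1.
  case: (farP e y c1) => [E|//|y1]; first by absurd_eq E.
  have Qy : joined Q y by apply: (joined_common (u := c4) (w := c1) (t := c2)) => //; known.
  by case: (pentagon_full Qrig C Qy) => [[]E|[]E]; absurd_eq E.
have [f [Wf f4 f1 eyf]] : exists f, [/\ W f, h f c4, h f c1 & e y f].
  by apply: (@response1 y c4 c1) => //; known.
(* Otherwise [f] lies in N(Q) and rigidity makes it [c5], which is H-adjacent to [y]. *)
have fQ : f \in Q.
  apply/negPn/negP => fnQ.
  have Qf : joined Q f.
    move=> g gQ; case: (farP e g f) => [E|gf|//]; first by rewrite -E gQ in fnQ.
    exfalso; apply: (no_square (x := c4) (w := c1) (y := g) (r := f)) => //.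
      exact: Q4.
    exact: Q1.
  have E : f = c5 by apply: (Qrig c5 f c4 c1) => //; known.
  absurd_eq E.
have [f2 f3 f5] : [/\ h f c2, h f c3 & h f c5] by split; [apply: Q2|apply: Q3|apply: Q5].
(* The exchange preserves the cardinality, so the new clique is again rigid. *)
pose Q' c := c |: Q :\ f.
have Q'P c : joined Q c -> [/\ clique (Q' c), rigid (Q' c) &
    forall x, joined (Q' c) x <-> h c x /\ joined (Q :\ f) x].
  move=> Qc.
  have clQf : clique (Q :\ f).
    by move=> a b /setD1P[_ aQ] /setD1P[_ bQ]; apply: clQ.
  have Qfc : joined (Q :\ f) c by move=> a /setD1P[_ /Qc].
  have clQ' : clique (Q' c) by apply: clique_setU1.
  split=> //.
    apply: rig => //; rewrite cardsU1 (joined_notin Qfc).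
    by rewrite -cardQ (cardsD1 f Q) fQ.
  move=> x; split=> [Qx|[cx Qx]]; last exact: joined_setU1.
  by split=> [|a aQ]; apply: Qx; rewrite !inE ?eqxx // -in_setD1 aQ orbT.
have Qf' x : joined Q x -> joined (Q :\ f) x by move=> Qx a /setD1P[_ /Qx].
have Qff : joined (Q :\ f) f.
  move=> a /setD1P[af aQ]; case: (clQ a f aQ fQ) => // E.
  by rewrite E eqxx in af.
have [cl1 rig1 joined1] := Q'P c1 Q1; have [cl4 rig4 joined4] := Q'P c4 Q4.
have [z [q C1]] : exists z q, pentagon (Q' c1) f c2 z q c5.
  apply: pentagon_exists => //; try known; apply/joined1; split; try known; exact: Qf'.
have [z' [q' C4]] : exists z' q', pentagon (Q' c4) f c3 z' q' c5.
  apply: pentagon_exists => //; try known; apply/joined4; split; try known; exact: Qf'.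
have [[_ _ Wz _ _] [_ _ /joined1[z1 Qz] _ _] [_ z2 _ _ _] [efz _ ez5 _ _]] := C1.
(* All [c1] to [c5] are H-adjacent to [f], so a vertex G-adjacent to [f] misses one of any two that
   are G-adjacent. *)
have away i j x : e i j -> h f i -> h f j -> h x i -> h x j -> e f x -> False.
  by move=> ij fi fj xi xj fx; apply: (no_square ij fi fj xi xj fx).
have ez4 : e z c4.
  case: (farP e z c4) => [E|//|z4]; first by absurd_eq E.
  by case: (@away c2 c4 z); known.
have ez3 : e z c3.
  case: (farP e z c3) => [E|//|z3]; first by absurd_eq E.
  by case: (@away c1 c3 z); known.
(* Being G-adjacent to [f], this [x] can only be [z'] or [q'] on the second 5-cycle. *)
have [x [Wx x4 xz efx]] : exists x, [/\ W x, h x c4, h x z & e f x].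
  by apply: (@response1 f c4 z) => //; known.
have Qx : joined (Q' c4) x.
  apply/joined4; split; first known.
  by apply: (joined_common (u := c4) (w := z) (t := f)) => //; try known; exact: Qf'.
case: (pentagon_full rig4 C4 Qx) => [[]E|[]E]; try absurd_eq E.
- have x3 : h x c3 by case: C4 => _ _ [_ + _ _ _] _; rewrite E hC.
  case: (farP e x c2) => [E2|x2|x2]; first by absurd_eq E2.
    by apply: (no_square (x := z) (w := c3) (y := x) (r := c2)); known.
  by case: (@away c2 c4 x); known.
- have x5 : h x c5 by case: C4 => _ _ [_ _ _ + _] _; rewrite E.
  case: (farP e x c1) => [E1|x1|x1]; first by absurd_eq E1.
    by apply: (no_square (x := z) (w := c5) (y := x) (r := c1)); known.
  by case: (@away c1 c4 x); known.
Qed.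

End Undominated.

(** * Removing a dominated vertex *)

Lemma pinned_absurd (T : finType) (e : rel T) (S : T -> T -> T -> Prop) x y c :
  closed_sets_trivial e -> evasion e S ->
  (forall z, far e x z -> ~~ e y z) ->
  S x c y -> False.
Proof.
move=> conn [_ safe next] dom Sxc.
have Sxy : S x y y.
  apply: (conn (fun d => S x d y) _ c) => // d d' Sxd dd'.
  have [r yr Sr] := next _ _ _ x d' Sxd (introT orP (or_introl (eqxx x))) (e_move dd').
  have [/dom yrN _] := safe _ _ _ Sr.
  by move: yr; rewrite /move (negPf yrN) orbF => /eqP->.
by have [_ /farxx] := safe _ _ _ Sxy.
Qed.

Lemma evasion_swap (T : finType) (e : rel T) (S : T -> T -> T -> Prop) :
  evasion e S -> evasion e (fun c d => S d c).
Proof.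
case=> start safe next; split=> [c d|c d r /safe[]|c d r c' d' Sdc cc' dd'] //.
exact: next Sdc dd' cc'.
Qed.

Section Dominated.
Variables (T : finType) (e : rel T) (S : T -> T -> T -> Prop) (x y : T).
Hypotheses (neq_xy : x != y) (dom : forall z, far e x z -> ~~ e y z).
Hypotheses (eC : symmetric e) (conn : closed_sets_trivial e) (evS : evasion e S).

Definition punctured : finType := {z : T | z != y}.
Definition punctured_rel : rel punctured := relpre val e.
(** The retraction sending [y] to [x], obtained as the default value of [insubd]. *)
Definition shadow (z : T) : punctured := insubd (exist _ x neq_xy : punctured) z.

Lemma val_shadow z : val (shadow z) = if z == y then x else z.
Proof. by rewrite val_insubd; case: eqP. Qed.

Lemma shadow_val (a : punctured) : shadow (val a) = a.
Proof. exact: valKd. Qed.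

Lemma move_punctured a b : move punctured_rel a b = move e (val a) (val b).
Proof. by rewrite /move val_eqE. Qed.

Lemma far_punctured a b : far punctured_rel a b = far e (val a) (val b).
Proof. by rewrite /far move_punctured. Qed.

Lemma move_shadow a b : move e a b -> move punctured_rel (shadow a) (shadow b).
Proof.
have moveC c d : move e c d = move e d c by rewrite /move eq_sym eC.
have from_y c : move e y c -> c != y -> move e x c.
  move=> yc neq_cy; apply: contraLR yc => /dom ycN.
  by rewrite /move negb_or ycN eq_sym neq_cy.
rewrite move_punctured !val_shadow.
have [->|ay] := eqVneq a y; have [->|by_] := eqVneq b y => // ab.
- by rewrite /move eqxx.
- exact: from_y.
- by rewrite moveC; apply: from_y => //; rewrite moveC.
Qed.

Lemma conn_punctured : closed_sets_trivial punctured_rel.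
Proof.
move=> B closedB a b Ba.
have closed_shadow c d : B (shadow c) -> e c d -> B (shadow d).
  move=> Bc cd; have /orP[/eqP<-//|] := move_shadow (e_move cd).
  exact: closedB.
by have := conn closed_shadow (x := val a) (val b); rewrite !shadow_val; apply.
Qed.

(* Capturing the shadow must yield a win: a cop on [x] with the robber on [y]
   pins the robber there, and the other cop walks to [y]. *)
Lemma far_shadow (R : T -> T -> T -> Prop) c d r :
  evasion e R -> c != y -> R c d r -> far e c (val (shadow r)).
Proof.
move=> evR cy Rcdr; rewrite val_shadow.
have [_ safe next] := evR; have [cr _] := safe _ _ _ Rcdr.
case: eqP => // ry; rewrite {}ry in Rcdr cr.
apply/negP => cx.
have [r' yr Rx] := next _ _ _ x d Rcdr cx (introT orP (or_introl (eqxx d))).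
have [/dom yrN _] := safe _ _ _ Rx.
move: yr; rewrite /move (negPf yrN) orbF => /eqP yr; rewrite -yr in Rx.
exact: pinned_absurd evR dom Rx.
Qed.

(** The robber evades in the whole graph against cops that avoid [y]; his shadow is the robber of
    the smaller graph. *)
Lemma evasion_punctured : evasion punctured_rel
  (fun c d r => exists2 s, shadow s = r & S (val c) (val d) s).
Proof.
have [start safe next] := evS; split=> [c d|c d r [s <- Ss]|c d r c' d' [s <- Ss]].
- by have [s Ss] := start (val c) (val d); exists (shadow s), s.
- rewrite !far_punctured; split; first exact: (far_shadow evS (valP c) Ss).
  exact: (far_shadow (evasion_swap evS) (valP d) Ss).
- rewrite !move_punctured => cc' dd'; have [s' ss' Ss'] := next _ _ _ _ _ Ss cc' dd'.
  by exists (shadow s'); [apply: move_shadow | exists s'].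
Qed.

End Dominated.

Lemma no_evasion (T : finType) (e : rel T) (S : T -> T -> T -> Prop) (x0 : T) :
  symmetric e -> irreflexive e -> no_2K2 e -> closed_sets_trivial e ->
  evasion e S -> False.
Proof.
have [n] := ubnP #|T|; elim: n => // n IHn in T e S x0 *.
move=> leTn eC eI free conn evS.
have [undom|] := pselect (undominated e).
  exact: undominated_no_evasion undom evS x0.
case=> x y neq_xy; apply: contrapT => no_z.
have dom z : far e x z -> ~~ e y z.
  by move=> xz; apply/negP => yz; apply: no_z; exists z.
have ev' := evasion_punctured neq_xy dom eC conn evS.
apply: (IHn _ _ _ (shadow neq_xy x) _ _ _ _ (conn_punctured neq_xy dom eC conn) ev').
- rewrite card_sig -ltnS; apply: leq_trans leTn; rewrite ltnS.
  apply: leq_trans (_ : #|[set~ y]| < _); last by rewrite cardsC1 prednK //; apply/card_gt0P; exists y.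
  by rewrite ltnS subset_leq_card //; apply/subsetP => z; rewrite !inE.
- by move=> a b; apply: eC.
- by move=> a; apply: eI.
- move=> a b c d; rewrite !far_punctured; exact: free.
Qed.

(** * Induced copies of $2K_2$ *)

Lemma free_of_embedding (S T : finType) (f : rel S) (e : rel T) (w : S -> T) :
  free_of f e -> injective w -> (forall i j, e (w i) (w j) = f i j) -> False.
Proof.
move=> free w_inj wf; apply: (free [set x in codom w]).
have wP (x : {x : T | x \in [set x in codom w]}) : val x \in codom w.
  by have := valP x; rewrite inE.
exists (fun x => iinv (wP x)) => [|x y]; last by rewrite -wf !f_iinv.
have wA i : w i \in [set x in codom w] by rewrite inE codom_f.
exists (fun i => exist _ (w i) (wA i)) => [x|i].
  by apply: val_inj; rewrite /= f_iinv.
by apply: w_inj; rewrite f_iinv.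
Qed.

Lemma free_of_two_K2 (T : finType) (e : rel T) :
  symmetric e -> irreflexive e -> free_of two_K2 e -> no_2K2 e.
Proof.
move=> eC eI free a b c d ab cd ac ad bc bd.
pose w (i : 'I_2 + 'I_2) := match i with
  | inl i => if i == ord0 then a else b
  | inr i => if i == ord0 then c else d
  end.
have farN u v : far e u v -> (u == v) = false /\ e u v = false.
  by rewrite /far /move negb_or => /andP[/negPf-> /negPf->].
have [[ac1 ac2] [ad1 ad2]] := (farN _ _ ac, farN _ _ ad).
have [[bc1 bc2] [bd1 bd2]] := (farN _ _ bc, farN _ _ bd).
have eN u v : e u v -> (u == v) = false.
  by move=> uv; apply/eqP => E; rewrite E eI in uv.
have [abN cdN] := (eN _ _ ab, eN _ _ cd).
apply: (free_of_embedding (w := w) free).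
- by move=> [[[|[|//]] ?]|[[|[|//]] ?]] [[[|[|//]] ?]|[[|[|//]] ?]] /= /eqP;
    rewrite ?(eq_sym b a) ?(eq_sym c) ?(eq_sym d a) ?(eq_sym d b) ?(eq_sym d c)
      ?ac1 ?ad1 ?bc1 ?bd1 ?abN ?cdN // => _; congr (_ _); apply: val_inj.
- by move=> [[[|[|//]] ?]|[[|[|//]] ?]] [[[|[|//]] ?]|[[|[|//]] ?]] /=;
    rewrite /complete /= ?eI ?ab ?cd ?ac2 ?ad2 ?bc2 ?bd2 // eC ?ab ?cd ?ac2 ?ad2 ?bc2 ?bd2.
Qed.

(** * Evasion when two cops do not win *)

Section TwoCops.
Variables (T : finType) (e : rel T).

Definition two_cops (c d : T) : {ffun 'I_2 -> T} :=
  [ffun i => if i == ord0 then c else d].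

Lemma evasion_of_not_win : ~ cops_win e 2 ->
  evasion e (fun c d r => forall n, ~~ win e n (two_cops c d) r).
Proof.
have win_step c d r c' d' : move e c c' -> move e d d' ->
    c' = r \/ d' = r \/ (forall r', move e r r' -> exists n, win e n (two_cops c' d') r') ->
    exists n, win e n (two_cops c d) r.
  move=> cc' dd' H.
  have [n Hn] : exists n, [exists i, two_cops c' d' i == r] ||
      [forall r', move e r r' ==> win e n (two_cops c' d') r'].
    case: H => [<-|[<-|/(_ _)H]].
    - by exists 0; apply/orP; left; apply/existsP; exists ord0; rewrite ffunE.
    - by exists 0; apply/orP; left; apply/existsP; exists ord_max; rewrite ffunE.
    have /choice[N HN] r' : exists n, move e r r' -> win e n (two_cops c' d') r'.
      by have [/H[n]|] := boolP (move e r r'); [exists n | exists 0].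
    (* The robber has finitely many replies, so the largest of their bounds serves all of them. *)
    exists (\max_r' N r'); apply/orP; right; apply/forallP => r'; apply/implyP => /HN.
    exact/win_leq/leq_bigmax.
  exists n.+1; apply/existsP; exists (two_cops c' d'); rewrite Hn andbT.
  by apply/forallP => i; rewrite !ffunE; case: ifP.
have stay x : move e x x by rewrite /move eqxx.
move=> nwin; split=> [c d|c d r S|c d r c' d' S cc' dd'].
- apply: contrapT => no_r; apply: nwin; apply: (@win_cops_win _ _ _ (two_cops c d)) => r.
  apply: contrapT => no_n; apply: no_r; exists r => n.
  by apply/negP => rn; apply: no_n; exists n.
- split; apply/negP => mv.
    have [n] := win_step c d r r d mv (stay d) (or_introl erefl).
    by apply/negP/S.
  have [n] := win_step c d r c r (stay c) mv (or_intror (or_introl erefl)).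
  by apply/negP/S.
- apply: contrapT => no_r; have [|n] := win_step c d r c' d' cc' dd'; last by apply/negP/S.
  right; right=> r' rr'; apply: contrapT => no_n; apply: no_r; exists r' => // n.
  by apply/negP => rn; apply: no_n; exists n.
Qed.

End TwoCops.

Theorem theorem4p6 (T : finType) (e : rel T)
  (nonempty : 0 < #|T|) (simple : simple_graph e) (conn : connected_graph e)
  (free : free_of two_K2 e) : cop_number e <= 2.
Proof.
have [eC eI] := simple; have [x0 _] := card_gt0P nonempty.
suff win2 : cops_win e 2.
  by rewrite /cop_number; case: ex_minnP => m _; apply; apply/asboolP.
apply: contrapT => /evasion_of_not_win.
apply: (no_evasion x0 eC eI (free_of_two_K2 eC eI free)) => B closedB x y.
have /connectP[p] := conn x y; elim: p x => [|z p IHp] x /= => [_ -> //|].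
by case/andP=> /closedB xz /IHp{}IHp /IHp{}IHp /xz.
Qed.
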